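(* Let $I$ be a finite simple graph and let $a,b$ be two distinct vertices of $I$. Then \[ {}^\partial\varepsilon_{I}(z)-{}^\partial\varepsilon_{I_{ab}'}(z)-{}^\partial\varepsilon_{\tilde{I}_{ab}}(z)+{}^\partial\varepsilon_{\tilde{I}_{ab}'}(z)=0 . \]
   Context: For a finite simple graph $I$ with adjacency matrix $M_I$ over $\mathbb{Z}_2$ (entry $1$ iff the two vertices are adjacent, zero diagonal), and $A\subseteq V(I)$, let $M_A$ be the principal submatrix of $M_I$ indexed by $A$ (the adjacency matrix of the induced subgraph on $A$), and $A^c=V(I)\setminus A$. The partial-dual genus polynomial of $I$ is ${}^\partial\varepsilon_I(z)=\sum_{A\subseteq V(I)} z^{\operatorname{rank}(M_A)+\operatorname{rank}(M_{A^c})}$, where rank is over $\mathbb{Z}_2$ and the empty matrix has rank $0$. For vertices $a,b$: $I_{ab}'$ is the graph obtained from $I$ by toggling the adjacency between $a$ and $b$ (removing the edge $ab$ if present, adding it otherwise). $\tilde{I}_{ab}$ is obtained from $I$ as follows: let $c_1,\dots,c_k$ be the neighbours of $b$ other than $a$; toggle the adjacency between $a$ and each $c_i$, $1\le i\le k$. Finally $\tilde{I}_{ab}'$ denotes the graph obtained by applying both operations, i.e. $(\tilde{I}_{ab})'_{ab}=\widetilde{(I_{ab}')}_{ab}$. *)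

(* Defs.v *)
From mathcomp Require Import all_boot all_order all_algebra.

Set Implicit Arguments.
Unset Strict Implicit.
Unset Printing Implicit Defensive.

Import GRing.Theory.
Local Open Scope ring_scope.

Record sgraph (V : finType) := SGraph {
  adj :> rel V;
  adj_sym : symmetric adj;
  adj_irrefl : irreflexive adj
}.

Section Matrices.
Variables (V : finType) (G : sgraph V).

Definition adjmx : 'M['F_2]_#|V| :=
  \matrix_(i, j) (adj G (enum_val i) (enum_val j))%:R.

Definition adjmx_on (A : {set V}) : 'M['F_2]_#|A| :=
  mxsub (fun i => enum_rank (enum_val i)) (fun j => enum_rank (enum_val j))
        adjmx.

Definition pdgenus : {poly int} :=
  \sum_(A : {set V}) 'X^(\rank (adjmx_on A) + \rank (adjmx_on (~: A))).

End Matrices.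

Section Toggling.
Variables (V : finType) (G : sgraph V).

(* The guard x != y keeps the graph loopless; it only matters when a \in S,
   and toggle_edge and toggle_nbrs below avoid this case for a != b. *)
Definition toggle_rel (a : V) (S : {set V}) : rel V := fun x y =>
  adj G x y (+)
  [&& x != y & ((x == a) && (y \in S)) || ((y == a) && (x \in S))].

Lemma toggle_rel_sym a S : symmetric (toggle_rel a S).
Proof. by move=> x y; rewrite /toggle_rel adj_sym eq_sym orbC. Qed.

Lemma toggle_rel_irrefl a S : irreflexive (toggle_rel a S).
Proof. by move=> x; rewrite /toggle_rel adj_irrefl eqxx. Qed.

Definition toggle (a : V) (S : {set V}) : sgraph V :=
  SGraph (toggle_rel_sym a S) (toggle_rel_irrefl a S).

(* $I'_{ab}$ *)
Definition toggle_edge (a b : V) : sgraph V := toggle a [set b].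

(* $\tilde I_{ab}$ *)
Definition toggle_nbrs (a b : V) : sgraph V :=
  toggle a ([set c | adj G b c] :\ a).

End Toggling.

Lemma toggle_edge_nbrsC (V : finType) (G : sgraph V) (a b : V) :
  a != b ->
  adj (toggle_edge (toggle_nbrs G a b) a b) =2
  adj (toggle_nbrs (toggle_edge G a b) a b).
Proof.
move=> ab x y; rewrite /= /toggle_rel /= /toggle_rel !inE.
have [->|xa] := eqVneq x a; have [->|ya] := eqVneq y a;
  rewrite ?eqxx ?(eq_sym b a) ?(negbTE ab) ?andbF ?orbF ?andbT ?addbF //=;
  by rewrite ?(negbTE xa) ?(negbTE ya) ?andbF ?addbF //= addbAC.
Qed.

(* Main.v *)
Require Import Defs.
From mathcomp Require Import all_boot all_order all_algebra.
Import GRing.Theory.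
Local Open Scope ring_scope.

Set Implicit Arguments.
Unset Strict Implicit.

(** The four-term combination vanishes for each subset A separately.  If a and b
    lie in the same block of {A, ~: A}, adding row and column b to row and column
    a of the adjacency matrix is a congruence turning G into toggle_nbrs G a b
    on that block, so the ranks agree.  If A separates a from b, toggling the
    edge ab changes neither of the two induced subgraphs. *)

Lemma adjmx_onE (V : finType) (G : sgraph V) (A : {set V}) i j :
  adjmx_on G A i j = (adj G (enum_val i) (enum_val j))%:R.
Proof. by rewrite !mxE !enum_rankK. Qed.

Lemma eq_adjmx_on (V : finType) (G H : sgraph V) (A : {set V}) :
  {in A &, adj G =2 adj H} -> adjmx_on G A = adjmx_on H A.
Proof. by move=> eqGH; apply/matrixP=> i j; rewrite !adjmx_onE eqGH ?enum_valP. Qed.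

(** Every toggled pair joins [a] to a vertex of [S], so no such pair lies inside [A]. *)
Lemma toggle_out (V : finType) (G : sgraph V) (a : V) (S A : {set V}) :
  (a \notin A) || [disjoint S & A] ->
  adjmx_on (toggle G a S) A = adjmx_on G A.
Proof.
move=> aSA; apply: eq_adjmx_on => x y xA yA; rewrite /= /toggle_rel.
case/orP: aSA => [aA | dSA].
  have neqa z : z \in A -> (z == a) = false.
    by move=> zA; apply: contraNF aA => /eqP <-.
  by rewrite !neqa // andbF addbF.
by rewrite !(disjointFl dSA) // !andbF addbF.
Qed.

Lemma mul_delta_mxE (R : pzRingType) (m n p : nat) (i0 : 'I_m) (k0 : 'I_n)
    (M : 'M[R]_(n, p)) i j :
  (delta_mx i0 k0 *m M) i j = (i == i0)%:R * M k0 j.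
Proof.
rewrite mxE (bigD1 k0) //= big1 ?addr0 ?mxE ?eqxx ?andbT // => k /negbTE kk0.
by rewrite mxE kk0 andbF mul0r.
Qed.

(** Since [i != k], [delta_mx i k] squares to zero, so flipping its sign gives the inverse. *)
Lemma transvection_unit (R : comUnitRingType) (n : nat) (i k : 'I_n) :
  i != k -> 1%:M + delta_mx i k \in @unitmx R n.
Proof.
move=> ik; suff /mulmx1_unit[] : (1%:M + delta_mx i k : 'M[R]_n)
  *m (1%:M - delta_mx i k) = 1%:M by [].
by rewrite mulmxDl !mulmxBr !mul1mx mulmx1 mul_delta_mx_0 1?eq_sym // subr0 subrK.
Qed.

Lemma mxrank_congr (F : fieldType) (n : nat) (P M : 'M[F]_n) :
  P \in unitmx -> \rank (P *m M *m P^T) = \rank M.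
Proof.
move=> uP; rewrite mxrankMfree ?row_free_unit ?unitmx_tr //.
by rewrite eqmxMfull ?row_full_unit.
Qed.

Lemma natr_addb_F2 (b c : bool) : (b (+) c)%:R = b%:R + c%:R :> 'F_2.
Proof. by case: b c => [] []; apply: val_inj. Qed.

Lemma rank_toggle_nbrs (V : finType) (G : sgraph V) (a b : V) (A : {set V}) :
  a != b -> (a \in A) = (b \in A) ->
  \rank (adjmx_on (toggle_nbrs G a b) A) = \rank (adjmx_on G A).
Proof.
move=> ab eqab; have [aA | aA] := boolP (a \in A); last by rewrite toggle_out ?aA.
have bA : b \in A by rewrite -eqab.
pose ia := enum_rank_in aA a; pose ib := enum_rank_in aA b.
have va : enum_val ia = a by rewrite enum_rankK_in.
have vb : enum_val ib = b by rewrite enum_rankK_in.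
have iab : ia != ib by apply: contraNneq ab => iab; rewrite -va iab vb.
rewrite -(@mxrank_congr _ _ (1%:M + delta_mx ia ib) (adjmx_on G A));
  last exact: transvection_unit.
congr mxrank; apply/matrixP=> i j.
rewrite linearD /= trmx1 trmx_delta mulmxDl mul1mx mulmxDr mulmx1.
set M := adjmx_on G A; set N := M + _.
have NdE : (N *m delta_mx ib ia) i j = (j == ia)%:R * N i ib.
  (* Transposing turns this column operation into a row operation. *)
  have -> : N *m delta_mx ib ia = (delta_mx ia ib *m N^T)^T.
    by rewrite trmx_mul trmxK trmx_delta.
  by rewrite mxE mul_delta_mxE mxE.
have NE k l : N k l = M k l + (k == ia)%:R * M ib l.
  by rewrite mxE mul_delta_mxE.
rewrite [RHS]mxE NdE !NE !adjmx_onE.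
(* The zero diagonal entry at [b] keeps the entry [ab] unchanged by the column operation, matching
   the removal of [a] from the toggled set. *)
rewrite vb adj_irrefl mulr0 addr0 /= /toggle_rel.
rewrite -(inj_eq enum_val_inj i) -(inj_eq enum_val_inj j) va.
rewrite (adj_sym G _ b).
set x := enum_val i; set y := enum_val j.
(* Sums over ['F_2] become exclusive or, which leaves a boolean identity. *)
rewrite -!natrM !mulnb -!natr_addb_F2 !inE; congr _%:R.
have [->|xa] := eqVneq x a; have [->|ya] := eqVneq y a;
  rewrite ?eqxx ?(eq_sym a y) ?xa ?(negbTE ya) ?adj_irrefl ?andbF ?orbF ?addbF //=.
(* At the diagonal entry of [a], the row and column operations each contribute [adj G b a]; the two
   cancel in characteristic 2. *)
by case: (adj G b a).
Qed.

Lemma toggle_edge_sep (V : finType) (G : sgraph V) (a b : V) (A : {set V}) :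
  ~~ ((a \in A) && (b \in A)) -> adjmx_on (toggle_edge G a b) A = adjmx_on G A.
Proof. by rewrite negb_and => sep; rewrite toggle_out // disjoints1. Qed.

Unset Implicit Arguments.

Theorem theorem1p2 (V : finType) (G : sgraph V) (a b : V) (hab : a != b) :
  pdgenus G - pdgenus (toggle_edge G a b) - pdgenus (toggle_nbrs G a b)
    + pdgenus (toggle_edge (toggle_nbrs G a b) a b) = 0.
Proof.
rewrite /pdgenus -!sumrB -big_split big1 //= => A _.
have [eqab | neqab] := eqVneq (a \in A) (b \in A).
  (* In this order the fourth graph is [toggle_nbrs] of the second, so the fourth term cancels the
     second just as the third cancels the first. *)
  have swapE B : adjmx_on (toggle_edge (toggle_nbrs G a b) a b) B
               = adjmx_on (toggle_nbrs (toggle_edge G a b) a b) B.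
    by apply: eq_adjmx_on => x y _ _; apply: toggle_edge_nbrsC.
  have eqabC : (a \in ~: A) = (b \in ~: A) by rewrite !inE eqab.
  by rewrite !swapE !rank_toggle_nbrs // addrAC subrK subrr.
(* Now the first term cancels the second, and the third cancels the fourth. *)
rewrite !toggle_edge_sep ?subrr ?sub0r ?addNr // ?inE;
  by move: neqab; case: (a \in A); case: (b \in A).
Qed.
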